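(* Let $(A,\theta_A)$ and $(B,\theta_B)$ be two 3-LieDer pairs. There is a one-to-one correspondence between equivalence classes of abelian extensions of $(B,\theta_B)$ by $(A,\theta_A)$ and the second cohomology group $\mathcal H^2_{\rm 3-LieDer}(B;A)$.
   Context: Throughout, $\mathbb F$ is an algebraically closed field of characteristic $0$ and all vector spaces are finite-dimensional over $\mathbb F$. A 3-Lie algebra is a vector space $L$ with a skew-symmetric trilinear map $[\cdot,\cdot,\cdot]_L$ satisfying $[x_1,x_2,[x_3,x_4,x_5]]=[[x_1,x_2,x_3],x_4,x_5]+[x_3,[x_1,x_2,x_4],x_5]+[x_3,x_4,[x_1,x_2,x_5]]$. A derivation is a linear map $\theta_L:L\to L$ with $\theta_L[x,y,z]=[\theta_L x,y,z]+[x,\theta_L y,z]+[x,y,\theta_L z]$. A 3-LieDer pair $(L,\theta_L)$ is a 3-Lie algebra with a derivation; a morphism of 3-LieDer pairs is a 3-Lie algebra morphism commuting with the derivations. An abelian extension of $(B,\theta_B)$ by $(A,\theta_A)$ is a short exact sequence of 3-LieDer pair morphisms $0\to(A,\theta_A)\xrightarrow{i}(L,\theta_L)\xrightarrow{\pi}(B,\theta_B)\to0$ such that $A$ (identified with $i(A)$) is an abelian ideal of $L$, i.e. $[u,v,\cdot]_L=0$ for all $u,v\in A$. Two abelian extensions $(L_1,\theta_{L_1})$, $(L_2,\theta_{L_2})$ of $(B,\theta_B)$ by $(A,\theta_A)$, with maps $i_1,\pi_1$ and $i_2,\pi_2$, are equivalent if there is a 3-LieDer pair morphism $\eta:(L_1,\theta_{L_1})\to(L_2,\theta_{L_2})$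 with $\eta\circ i_1=i_2$ and $\pi_2\circ\eta=\pi_1$. A representation of a 3-LieDer pair $(B,\theta_B)$ on a vector space $A$ is a pair $(\rho,\theta_A)$, $\rho:\wedge^2B\to\mathrm{End}(A)$ linear, $\theta_A\in\mathrm{End}(A)$, such that $\rho(x_1,x_2)\rho(x_3,x_4)=\rho([x_1,x_2,x_3],x_4)+\rho(x_3,[x_1,x_2,x_4])+\rho(x_3,x_4)\rho(x_1,x_2)$, $\rho(x_1,[x_2,x_3,x_4])=\rho(x_3,x_4)\rho(x_1,x_2)-\rho(x_2,x_4)\rho(x_1,x_3)+\rho(x_2,x_3)\rho(x_1,x_4)$, and $\theta_A\rho(x,y)-\rho(x,y)\theta_A=\rho(\theta_Bx,y)+\rho(x,\theta_By)$. A section of an abelian extension is a linear map $s:B\to L$ with $\pi\circ s=\mathrm{id}_B$. Put $\rho(x,y)(a)=[s(x),s(y),a]_L$ for $x,y\in B$, $a\in A$. This does not depend on $s$, $(A;\rho,\theta_A)$ is a representation of $(B,\theta_B)$, and equivalent abelian extensions give the same $\rho$. The group $\mathcal H^2_{\rm 3-LieDer}(B;A)$ is the second cohomology group with coefficients in the representation $(A;\rho,\theta_A)$, defined as follows. Let $\mathcal C^1_{\rm 3-LieDer}(B;A)=\mathrm{Hom}(B,A)$ and $\mathcal C^2_{\rm 3-LieDer}(B;A)=\mathrm{Hom}(\wedge^3B,A)\times\mathrm{Hom}(B,A)$. For $\alpha\in\mathrm{Hom}(B,A)$: $(\mathrm d\alpha)(x,y,z)=-\alpha([x,y,z]_B)+\rho(x,y)\alpha(z)+\rho(y,z)\alpha(x)-\rho(x,z)\alpha(y)$,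 $(\delta\alpha)(z)=\alpha(\theta_Bz)-\theta_A(\alpha(z))$. For $\psi\in\mathrm{Hom}(\wedge^3B,A)$: $(\delta\psi)(x,y,z)=\psi(\theta_Bx,y,z)+\psi(x,\theta_By,z)+\psi(x,y,\theta_Bz)-\theta_A\psi(x,y,z)$ and $$\begin{aligned}(\mathrm d\psi)(x_1,\dots,x_5)=&-\psi([x_1,x_2,x_3],x_4,x_5)-\psi(x_3,[x_1,x_2,x_4],x_5)-\psi(x_3,x_4,[x_1,x_2,x_5])+\psi(x_1,x_2,[x_3,x_4,x_5])\\&+\rho(x_1,x_2)\psi(x_3,x_4,x_5)-\rho(x_3,x_4)\psi(x_1,x_2,x_5)-\rho(x_4,x_5)\psi(x_1,x_2,x_3)+\rho(x_3,x_5)\psi(x_1,x_2,x_4).\end{aligned}$$ Put $\partial\alpha=(\mathrm d\alpha,-\delta\alpha)$ and $\partial(\psi,\lambda)=(\mathrm d\psi,\mathrm d\lambda+\delta\psi)$. Then $\mathcal H^2_{\rm 3-LieDer}(B;A)=\ker(\partial|_{\mathcal C^2_{\rm 3-LieDer}(B;A)})/\partial(\mathcal C^1_{\rm 3-LieDer}(B;A))$.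
   Formalization: A is assumed to have zero bracket (forced if any abelian extension exists), and a representation ρ of (B,θ_B) on (A,θ_A) is fixed: the classes counted are those of extensions inducing ρ, and H² is taken with coefficients in ρ, since the claim fails for all ρ together. *)

(* Defs.v *)
From HB Require Import structures.
From mathcomp Require Import all_boot all_algebra all_classical.
Set Implicit Arguments.
Unset Strict Implicit.
Unset Printing Implicit Defensive.
Import GRing.Theory.
Local Open Scope classical_set_scope.
Local Open Scope ring_scope.

(* Linear maps are elements of 'Hom(U, V). Maps of several arguments are plain
   curried functions together with a multilinearity predicate. *)
Section Multilinear.
Variables (F : fieldType) (U V : vectType F).

Definition bilinear2 (f : U -> U -> V) : Prop :=
  (forall y, linear (fun x => f x y)) /\ (forall x, linear (fun y => f x y)).

Definition trilinear (f : U -> U -> U -> V) : Prop :=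
  [/\ forall y z, linear (fun x => f x y z),
      forall x z, linear (fun y => f x y z)
    & forall x y, linear (fun z => f x y z)].

Definition skew2 (f : U -> U -> V) : Prop := forall x y, f y x = - f x y.

(* The two adjacent transpositions generate the symmetric group on the three
   arguments. *)
Definition skew3 (f : U -> U -> U -> V) : Prop :=
  (forall x y z, f y x z = - f x y z) /\ (forall x y z, f x z y = - f x y z).

End Multilinear.

Record lie3 (F : fieldType) := Lie3 {
  lie3_space :> vectType F;
  bracket : lie3_space -> lie3_space -> lie3_space -> lie3_space;
  bracket_trilinear : trilinear bracket;
  bracket_skew : skew3 bracket;
  bracket_fundamental : forall x1 x2 x3 x4 x5,
    bracket x1 x2 (bracket x3 x4 x5) =
      bracket (bracket x1 x2 x3) x4 x5
      + bracket x3 (bracket x1 x2 x4) x5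
      + bracket x3 x4 (bracket x1 x2 x5) }.

Notation "[ 'lie' x , y , z ]" := (bracket x y z)
  (format "[ 'lie'  x ,  y ,  z ]") : ring_scope.

Definition derivation (F : fieldType) (L : lie3 F) (D : 'End(L)) : Prop :=
  forall x y z : L,
    D [lie x, y, z] = [lie D x, y, z] + [lie x, D y, z] + [lie x, y, D z].

Record lie3Der (F : fieldType) := Lie3Der {
  lie3Der_alg :> lie3 F;
  theta : 'End(lie3Der_alg);
  theta_derivation : derivation theta }.

Arguments theta {F} L : rename.

Definition abelian_lie3 (F : fieldType) (L : lie3 F) : Prop :=
  forall x y z : L, [lie x, y, z] = 0.

Definition lie3Der_morphism (F : fieldType) (L1 L2 : lie3Der F)
    (f : 'Hom(L1, L2)) : Prop :=
  (forall x y z : L1, f [lie x, y, z] = [lie f x, f y, f z])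
  /\ (forall x : L1, f (theta L1 x) = theta L2 (f x)).

(* That the image of A is an ideal follows from exactness. *)
Record abelian_extension (F : fieldType) (B A : lie3Der F) := AbelianExtension {
  ext_pair :> lie3Der F;
  ext_inj : 'Hom(A, ext_pair);
  ext_proj : 'Hom(ext_pair, B);
  ext_inj_morphism : lie3Der_morphism ext_inj;
  ext_proj_morphism : lie3Der_morphism ext_proj;
  ext_inj_injective : lker ext_inj = 0%VS;
  ext_exact : limg ext_inj = lker ext_proj;
  ext_proj_surjective : limg ext_proj = fullv;
  ext_abelian : forall (u v : A) (x : ext_pair),
    [lie ext_inj u, ext_inj v, x] = 0 }.

Definition equivalent_extensions (F : fieldType) (B A : lie3Der F)
    (E1 E2 : abelian_extension B A) : Prop :=
  exists eta : 'Hom(E1, E2),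
    [/\ lie3Der_morphism eta,
        (eta \o ext_inj E1)%VF = ext_inj E2
      & (ext_proj E2 \o eta)%VF = ext_proj E1].

Record representation (F : fieldType) (B : lie3Der F) (A : vectType F)
    (thetaA : 'End(A)) := Representation {
  rho :> B -> B -> 'End(A);
  rho_bilinear : bilinear2 rho;
  rho_skew : skew2 rho;
  rho_comp : forall x1 x2 x3 x4,
    (rho x1 x2 \o rho x3 x4)%VF =
      rho [lie x1, x2, x3] x4 + rho x3 [lie x1, x2, x4]
      + (rho x3 x4 \o rho x1 x2)%VF;
  rho_bracket : forall x1 x2 x3 x4,
    rho x1 [lie x2, x3, x4] =
      (rho x3 x4 \o rho x1 x2)%VF - (rho x2 x4 \o rho x1 x3)%VF
      + (rho x2 x3 \o rho x1 x4)%VF;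
  rho_theta : forall x y,
    (thetaA \o rho x y)%VF - (rho x y \o thetaA)%VF =
      rho (theta B x) y + rho x (theta B y) }.

Section Extensions.
Variables (F : fieldType) (B A : lie3Der F).
Implicit Type E : abelian_extension B A.

Definition is_section E (s : 'Hom(B, E)) : Prop :=
  (ext_proj E \o s)%VF = \1%VF.

Definition induces E (r : B -> B -> 'End(A)) : Prop :=
  forall s : 'Hom(B, E), is_section s ->
  forall (x y : B) (a : A), ext_inj E (r x y a) = [lie s x, s y, ext_inj E a].

Lemma section_exists E : exists s : 'Hom(B, E), is_section s.
Proof.
exists (ext_proj E)^-1%VF; apply/lfunP=> x.
by rewrite comp_lfunE id_lfunE limg_lfunVK // ext_proj_surjective memvf.
Qed.

(* An abelian extension by A exists only if the bracket of A vanishes. *)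
Lemma extension_abelian E : abelian_lie3 A.
Proof.
move=> x y z; have inj_i : injective (ext_inj E).
  by apply/lker0P; rewrite ext_inj_injective.
by apply: inj_i; rewrite linear0 (ext_inj_morphism E).1 ext_abelian.
Qed.

Lemma equivalent_extensions_refl E : equivalent_extensions E E.
Proof.
exists \1%VF; split; last 2 first.
- by rewrite comp_lfun1l.
- by rewrite comp_lfun1r.
by split=> *; rewrite !id_lfunE.
Qed.

Lemma equivalent_extensions_trans E1 E2 E3 :
  equivalent_extensions E1 E2 -> equivalent_extensions E2 E3 ->
  equivalent_extensions E1 E3.
Proof.
move=> [f [[fb ft] fi fp]] [g [[gb gt] gi gp]]; exists (g \o f)%VF; split.
- by split=> *; rewrite !comp_lfunE /= ?fb ?gb ?ft ?gt.
- by rewrite -comp_lfunA fi.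
- by rewrite comp_lfunA gp.
Qed.

Lemma equivalent_extensions_sym E1 E2 :
  equivalent_extensions E1 E2 -> equivalent_extensions E2 E1.
Proof.
move=> [f [[fb ft] fi fp]].
have fiE a : f (ext_inj E1 a) = ext_inj E2 a by rewrite -fi comp_lfunE.
have fpE x : ext_proj E2 (f x) = ext_proj E1 x by rewrite -fp comp_lfunE.
have inj_f : lker f == 0%VS.
  apply/eqP/vspaceP=> x; rewrite memv0 memv_ker; apply/eqP/eqP=> [fx0|->];
    last exact: linear0.
  have : x \in lker (ext_proj E1) by rewrite memv_ker -fpE fx0 linear0.
  rewrite -ext_exact => /memv_imgP[a _ xE]; move: fx0; rewrite xE fiE.
  move=> /eqP; rewrite -memv_ker ext_inj_injective memv0 => /eqP->.
  by rewrite linear0.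
have surj_f y : exists x, y = f x.
  have [s sE] := section_exists E1.
  have : y - f (s (ext_proj E2 y)) \in lker (ext_proj E2).
    rewrite memv_ker linearB /= fpE -comp_lfunE.
    by rewrite (sE : (_ \o _)%VF = _) id_lfunE subrr.
  rewrite -ext_exact => /memv_imgP[a _ /eqP]; rewrite subr_eq => /eqP->.
  by exists (ext_inj E1 a + s (ext_proj E2 y)); rewrite linearD /= fiE.
have fK x : (f^-1)%VF (f x) = x by rewrite lker0_lfunK.
exists (f^-1)%VF; split.
- split=> [y1 y2 y3|y1]; have [x1 ->] := surj_f y1.
    have [x2 ->] := surj_f y2; have [x3 ->] := surj_f y3.
    by rewrite -fb !fK.
  by rewrite -ft !fK.
- by apply/lfunP=> a; rewrite comp_lfunE -fiE fK.
- apply/lfunP=> y; have [x ->] := surj_f y.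
  by rewrite comp_lfunE fK fpE.
Qed.

Lemma equivalent_extensions_induces E1 E2 r :
  equivalent_extensions E1 E2 -> induces E1 r -> induces E2 r.
Proof.
move=> /equivalent_extensions_sym[f [[fb ft] fi fp]] ind s sE x y a.
have inj_f : injective f.
  apply/lker0P/eqP/vspaceP=> u; rewrite memv0 memv_ker.
  apply/eqP/eqP=> [fu0|->]; last exact: linear0.
  have : u \in lker (ext_proj E2) by rewrite memv_ker -fp comp_lfunE fu0 linear0.
  rewrite -ext_exact => /memv_imgP[b _ uE]; move: fu0.
  rewrite uE -comp_lfunE fi => /eqP.
  by rewrite -memv_ker ext_inj_injective memv0 => /eqP->; rewrite linear0.
have fiE b : f (ext_inj E2 b) = ext_inj E1 b by rewrite -fi comp_lfunE.
apply: inj_f; rewrite fb !fiE (ind (f \o s)%VF) ?comp_lfunE //.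
by rewrite /is_section comp_lfunA fp.
Qed.

Lemma induces_unique E r1 r2 : induces E r1 -> induces E r2 -> r1 = r2.
Proof.
have [s sE] := section_exists E.
have inj_i : injective (ext_inj E).
  by apply/lker0P; rewrite ext_inj_injective.
move=> i1 i2; apply/funext => x; apply/funext => y; apply/lfunP => a.
by apply: inj_i; rewrite (i1 s) // (i2 s).
Qed.

Lemma induced_representation E :
  exists r : representation B (theta A), induces E r.
Proof.
have [s sE] := section_exists E.
set i := ext_inj E; set p := ext_proj E.
have psE x : p (s x) = x.
  by rewrite -comp_lfunE (sE : (_ \o _)%VF = _) id_lfunE.
have inj_i : injective i by apply/lker0P; rewrite ext_inj_injective.
have kerE u : p u = 0 -> exists a, u = i a.
  move=> /eqP; rewrite -memv_ker -ext_exact => /memv_imgP[a _ ->].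
  by exists a.
have pi a : p (i a) = 0.
  by apply/eqP; rewrite -memv_ker -ext_exact memv_img ?memvf.
have [ib it] := ext_inj_morphism E; have [pb pt] := ext_proj_morphism E.
rewrite -/i -/p in ib it pb pt.
have [l1 l2 l3] := @bracket_trilinear _ E; have [k1 k2] := @bracket_skew _ E.
have brD1 (u u' v w : E) : [lie u - u', v, w] = [lie u, v, w] - [lie u', v, w].
  by have := l1 v w (- 1) u' u; rewrite !scaleN1r ![- _ + _]addrC.
have ext1 (u u' v : E) a : p u = p u' -> [lie u, v, i a] = [lie u', v, i a].
  move=> uu'; have /kerE[b bE] : p (u - u') = 0.
    by rewrite linearB /= uu' subrr.
  by apply/eqP; rewrite -subr_eq0 -brD1 bE k2 ext_abelian oppr0.
have ext2 (u v v' : E) a : p v = p v' -> [lie u, v, i a] = [lie u, v', i a].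
  by move=> vv'; rewrite k1 (ext1 _ _ _ _ vv') -k1.
pose g x y (a : A) : A := (i^-1)%VF [lie s x, s y, i a].
have gE x y a : i (g x y a) = [lie s x, s y, i a].
  rewrite /g limg_lfunVK // ext_exact memv_ker pb -/p pi.
  have [_ _ l] := @bracket_trilinear _ B.
  have := l (p (s x)) (p (s y)) (- 1) 0 0.
  by rewrite scaler0 addr0 scaleN1r addNr => ->.
have g_lin x y : linear (g x y).
  by move=> k a a'; apply: inj_i; rewrite linearP /= !gE linearP l3.
pose r x y : 'End(A) :=
  let h := GRing.isLinear.Build F A A *:%R (g x y) (g_lin x y) in
  let gl : {linear A -> A} := HB.pack (g x y) h in linfun gl.
have rE u v a : [lie u, v, i a] = i (r (p u) (p v) a).
  rewrite lfunE /= gE; rewrite (ext1 u (s (p u))) ?psE //.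
  by rewrite (ext2 _ v (s (p v))) ?psE.
have rsE x y a : i (r x y a) = [lie s x, s y, i a] by rewrite rE !psE.
have r_bil : bilinear2 r.
  split=> x k y z; apply/lfunP=> a; apply: inj_i.
    by rewrite add_lfunE scale_lfunE linearP /= !rsE linearP l1.
  by rewrite add_lfunE scale_lfunE linearP /= !rsE linearP l2.
have r_skew : skew2 r.
  move=> x y; apply/lfunP=> a; apply: inj_i.
  by rewrite opp_lfunE linearN /= !rsE k1.
have r_comp x1 x2 x3 x4 : (r x1 x2 \o r x3 x4)%VF =
      r [lie x1, x2, x3] x4 + r x3 [lie x1, x2, x4]
      + (r x3 x4 \o r x1 x2)%VF.
  apply/lfunP=> a; apply: inj_i; rewrite !add_lfunE !comp_lfunE !linearD /=.
  rewrite [LHS]rsE rsE bracket_fundamental.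
  by rewrite !rE !pb !psE.
have r_br x1 x2 x3 x4 : r x1 [lie x2, x3, x4] =
      (r x3 x4 \o r x1 x2)%VF - (r x2 x4 \o r x1 x3)%VF
      + (r x2 x3 \o r x1 x4)%VF.
  apply/lfunP=> a; apply: inj_i.
  rewrite !add_lfunE opp_lfunE !comp_lfunE linearD linearB /=.
  have -> : i (r x1 [lie x2, x3, x4] a) =
      [lie i a, s x1, [lie s x2, s x3, s x4]].
    by rewrite k1 k2 opprK rE pb -/p !psE.
  have cyc (u v w : E) : [lie w, u, v] = [lie u, v, w] by rewrite k1 k2 opprK.
  rewrite bracket_fundamental !(cyc _ _ (i a)) !rE [X in X + _ + _]cyc.
  rewrite [X in _ + X + _]k2.
  by rewrite !rE !psE.
have r_th x y : (theta A \o r x y)%VF - (r x y \o theta A)%VF =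
      r (theta B x) y + r x (theta B y).
  apply/lfunP=> a; apply: inj_i.
  rewrite !add_lfunE opp_lfunE !comp_lfunE linearB linearD /= it -/i.
  rewrite !rsE theta_derivation -it addrK.
  by rewrite !rE !pt !psE.
exists (Representation r_bil r_skew r_comp r_br r_th) => s' sE' x y a /=.
have ps' z : p (s' z) = z.
  by rewrite -comp_lfunE (sE' : (_ \o _)%VF = _) id_lfunE.
by rewrite rE !ps'.
Qed.

(* Equivalence classes of the abelian extensions inducing [r]. Equivalent
   extensions induce the same representation, so a whole equivalence class is
   selected by one of its members. *)
Definition ext_class (r : representation B (theta A)) : Type :=
  {S : abelian_extension B A -> Prop |
    exists E, induces E r /\ S = equivalent_extensions E}.

End Extensions.

Section Cohomology.
Variables (F : fieldType) (B : lie3Der F) (A : vectType F) (thetaA : 'End(A)).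
Variable r : representation B thetaA.

Definition d_hom (alpha : 'Hom(B, A)) : B -> B -> B -> A := fun x y z =>
  - alpha [lie x, y, z] + r x y (alpha z) + r y z (alpha x) - r x z (alpha y).

Definition delta_hom (alpha : 'Hom(B, A)) : 'Hom(B, A) :=
  ((alpha \o theta B) - (thetaA \o alpha))%VF.

Definition delta_alt (psi : B -> B -> B -> A) : B -> B -> B -> A := fun x y z =>
  psi (theta B x) y z + psi x (theta B y) z + psi x y (theta B z)
  - thetaA (psi x y z).

Definition d_alt (psi : B -> B -> B -> A) : B -> B -> B -> B -> B -> A :=
  fun x1 x2 x3 x4 x5 =>
    - psi [lie x1, x2, x3] x4 x5 - psi x3 [lie x1, x2, x4] x5
    - psi x3 x4 [lie x1, x2, x5] + psi x1 x2 [lie x3, x4, x5]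
    + r x1 x2 (psi x3 x4 x5) - r x3 x4 (psi x1 x2 x5)
    - r x4 x5 (psi x1 x2 x3) + r x3 x5 (psi x1 x2 x4).

Definition cochain2_ambient : zmodType :=
  ((B -> B -> B -> A) * 'Hom(B, A))%type.

Definition cochain2 : set cochain2_ambient :=
  [set c | trilinear c.1 /\ skew3 c.1].

Definition partial1 (alpha : 'Hom(B, A)) : cochain2_ambient :=
  (d_hom alpha, - delta_hom alpha).

Definition partial2 (c : cochain2_ambient) :
    (B -> B -> B -> B -> B -> A) * (B -> B -> B -> A) :=
  (d_alt c.1, d_hom c.2 + delta_alt c.1).

Definition cocycle2 : set cochain2_ambient :=
  [set c | cochain2 c /\ partial2 c = 0].

Definition coboundary2 : set cochain2_ambient := range partial1.

(* The elements of ker / im, as cosets. *)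
Definition H2 : Type :=
  {S : set cochain2_ambient |
    exists c, cocycle2 c /\ S = [set c + b | b in coboundary2]}.

End Cohomology.

(* Main.v *)
From HB Require Import structures.
Require Import Defs.
From mathcomp Require Import all_boot all_algebra all_classical.
From mathcomp Require Import ring.
Set Implicit Arguments.
Unset Strict Implicit.
Unset Printing Implicit Defensive.
Import GRing.Theory.
Local Open Scope classical_set_scope.
Local Open Scope ring_scope.

(** An extension is determined up to equivalence by what a linear section s
    fails to preserve. The failures of s to commute with the brackets and with
    the derivations take values in A, and form the factor set (psi, lambda) of s:

      i (psi x y z) = [s x, s y, s z] - s [x, y, z],
      i (lambda x) = theta_E (s x) - s (theta_B x).

    Since E is the direct sum of s(B) and i(A), and since a bracket with one
    entry in i(A) is given by r while a bracket with two such entries vanishes,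
    the bracket and the derivation of E can be recovered from (psi, lambda); see
    [bracket_coordinates] and [theta_coordinates]. Four facts follow.

    - The fundamental identity and the derivation rule of E, read in the
      coordinates of s, say that the factor set is a 2-cocycle
      ([factor_set_cocycle]).
    - Two sections differ by some i o alpha with alpha : B -> A, and this
      changes the factor set by the coboundary of alpha. So the factor sets of
      E fill one coset of the coboundaries ([classifies_coset]).
    - An equivalence carries a section to a section with the same factor set;
      conversely, if s1 and s2 have the same factor set, then
      s1 x + i1 a |-> s2 x + i2 a is an equivalence
      ([classifies_equivalent], [equivalent_of_classifies]).
    - Every cocycle is the factor set of the section x |-> (x, 0) of an
      extension with underlying space B * A, whose bracket and derivation are
      copied from the coordinate formulas ([cocycle_realized]).

    Thus the relation [E has a section with factor set c] between extensions
    inducing r and 2-cocycles matches each equivalence class with one coset,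
    and each coset with one equivalence class. *)

(** * Identities in a vector space *)

(** Coordinates reduce an identity between vectors to identities between
    scalars, where [ring] applies. *)
Lemma coord_eq (F : fieldType) (V : vectType F) (u v : V) :
  (forall f : {linear V -> F^o}, f u = f v) -> u = v.
Proof.
move=> eq_uv; rewrite (coord_vbasis (memvf u)) (coord_vbasis (memvf v)).
by apply: eq_bigr => i _; congr (_ *: _); apply: eq_uv.
Qed.

(** Proves identities of sums in a vector space. A linear map applied to a vector
    counts as an atom, so sums inside it have to be expanded beforehand. *)
Ltac zmod :=
  let f := fresh in
  apply: coord_eq => f; rewrite !(linearD f, linearN f, linear0 f) /=; ring.

(** * Multilinear maps and representations *)

Section Trilinear.
Variables (F : fieldType) (U V : vectType F) (f : U -> U -> U -> V).
Hypothesis f_tri : trilinear f.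

Lemma trilinearD1 u v y z : f (u + v) y z = f u y z + f v y z.
Proof. by case: f_tri => l _ _; have := l y z 1 u v; rewrite !scale1r. Qed.

Lemma trilinearD2 x u v z : f x (u + v) z = f x u z + f x v z.
Proof. by case: f_tri => _ l _; have := l x z 1 u v; rewrite !scale1r. Qed.

Lemma trilinearD3 x y u v : f x y (u + v) = f x y u + f x y v.
Proof. by case: f_tri => _ _ l; have := l x y 1 u v; rewrite !scale1r. Qed.

Definition trilinearD := (trilinearD1, trilinearD2, trilinearD3).

Lemma trilinear0 :
  ((forall y z, f 0 y z = 0) * (forall x z, f x 0 z = 0)
   * (forall x y, f x y 0 = 0))%type.
Proof.
split; first split=> [y z|x z].
- by apply: (addrI (f 0 y z)); rewrite -trilinearD1 !addr0.
- by apply: (addrI (f x 0 z)); rewrite -trilinearD2 !addr0.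
- by move=> x y; apply: (addrI (f x y 0)); rewrite -trilinearD3 !addr0.
Qed.

End Trilinear.

Section Bilinear.
Variables (F : fieldType) (U V : vectType F) (f : U -> U -> V).
Hypothesis f_bil : bilinear2 f.

Lemma bilinear2_0 : ((forall y, f 0 y = 0) * (forall x, f x 0 = 0))%type.
Proof.
case: f_bil => l1 l2; split=> [y|x].
- by have := l1 y (- 1) 0 0; rewrite addr0 scaler0 scaleN1r addNr.
- by have := l2 x (- 1) 0 0; rewrite addr0 scaler0 scaleN1r addNr.
Qed.

End Bilinear.

Section Representation.
Variables (F : fieldType) (B : lie3Der F) (A : vectType F) (thetaA : 'End(A)).
Variable r : representation B thetaA.

Lemma rho_compE x1 x2 x3 x4 a : r x1 x2 (r x3 x4 a) =
  r [lie x1, x2, x3] x4 a + r x3 [lie x1, x2, x4] a + r x3 x4 (r x1 x2 a).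
Proof. by rewrite -comp_lfunE rho_comp !add_lfunE comp_lfunE. Qed.

Lemma rho_bracketE x1 x2 x3 x4 a : r x1 [lie x2, x3, x4] a =
  r x3 x4 (r x1 x2 a) - r x2 x4 (r x1 x3 a) + r x2 x3 (r x1 x4 a).
Proof. by rewrite rho_bracket !add_lfunE opp_lfunE !comp_lfunE. Qed.

Lemma rho_thetaE x y a : thetaA (r x y a) =
  r (theta B x) y a + r x (theta B y) a + r x y (thetaA a).
Proof.
by rewrite -add_lfunE -rho_theta add_lfunE opp_lfunE !comp_lfunE subrK.
Qed.

End Representation.

(** * Factor sets *)

Section Extension.
Variables (F : fieldType) (B A : lie3Der F).
Variables (r : representation B (theta A)) (E : abelian_extension B A).
Hypothesis Er : induces E r.
Let i := ext_inj E.
Let p := ext_proj E.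

Lemma ext_inj_inj : injective (ext_inj E).
Proof. by apply/lker0P; rewrite ext_inj_injective. Qed.

Lemma ext_projK a : ext_proj E (ext_inj E a) = 0.
Proof. by apply/eqP; rewrite -memv_ker -ext_exact memv_img ?memvf. Qed.

Lemma ext_injVK u : ext_proj E u = 0 -> ext_inj E ((ext_inj E)^-1%VF u) = u.
Proof. by move=> pu0; rewrite limg_lfunVK // ext_exact memv_ker pu0. Qed.

Lemma sectionK (s : 'Hom(B, E)) : is_section s -> cancel s (ext_proj E).
Proof. by move=> sE x; rewrite -comp_lfunE (sE : (_ \o _)%VF = _) id_lfunE. Qed.

Definition factor_set (s : 'Hom(B, E)) (c : cochain2_ambient B A) : Prop :=
  (forall x y z, ext_inj E (c.1 x y z) = [lie s x, s y, s z] - s [lie x, y, z])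
  /\ (forall x, ext_inj E (c.2 x) = theta E (s x) - s (theta B x)).

Section FixedSection.
Variable s : 'Hom(B, E).
Hypothesis sE : is_section s.

Lemma factor_set_exists : exists c, factor_set s c.
Proof.
have [pb pt] := ext_proj_morphism E.
exists (fun x y z => i^-1%VF ([lie s x, s y, s z] - s [lie x, y, z]),
        (i^-1 \o ((theta E \o s) - (s \o theta B)))%VF); split=> /= [x y z|x].
  by rewrite ext_injVK // linearB /= pb !sectionK // subrr.
rewrite comp_lfunE add_lfunE opp_lfunE !comp_lfunE ext_injVK //.
by rewrite linearB /= pt !sectionK // subrr.
Qed.

(** The splitting of E as the direct sum of s(B) and i(A). *)
Lemma ext_coordinates u :
  u = s (p u) + i (i^-1%VF (u - s (p u))).
Proof. by rewrite ext_injVK ?linearB /= ?sectionK ?subrr // addrC subrK. Qed.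

(** Expanding the bracket leaves eight terms; the four with two or three entries
    in i(A) vanish because i(A) is an abelian ideal, and skew-symmetry brings
    the entry in i(A) of the others to the last place, where r computes them. *)
Lemma bracket_coordinates c x y z a b d : factor_set s c ->
  [lie s x + i a, s y + i b, s z + i d] =
  s [lie x, y, z] + i (c.1 x y z + r x y d + r y z a - r x z b).
Proof.
move=> [cb _]; have T := @bracket_trilinear _ E.
have [k1 k2] := @bracket_skew _ E.
have ab a1 a2 u : [lie i a1, i a2, u] = 0 by exact: ext_abelian.
have ab2 a1 a2 u : [lie i a1, u, i a2] = 0 by rewrite k2 ab oppr0.
have ab3 a1 a2 u : [lie u, i a1, i a2] = 0 by rewrite k1 ab2 oppr0.
rewrite !(trilinearD T) !ab !ab2 !ab3 !addr0.
rewrite (k2 (s x) (s z) (i b)) (k1 (s y) (i a)) (k2 (s y) (s z)) opprK.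
rewrite !linearD linearN /= cb !(Er sE) -/i.
zmod.
Qed.

Lemma theta_coordinates c x a : factor_set s c ->
  theta E (s x + i a) = s (theta B x) + i (c.2 x + theta A a).
Proof.
move=> [_ ct]; rewrite !linearD /= ct (ext_inj_morphism E).2; zmod.
Qed.

(** The fundamental identity for s x1, ..., s x5 and the derivation rule for
    s x, s y, s z hold in E. Their components along s(B) are the same laws in B,
    and their components along i(A) are the two halves of the cocycle
    condition. *)
Lemma factor_set_cocycle c : factor_set s c -> cocycle2 r c.
Proof.
move=> cf; have [cb ct] := cf; have inj_i := ext_inj_inj.
have [l1 l2 l3] := @bracket_trilinear _ E.
have [m1 m2 m3] := @bracket_trilinear _ B.
have [k1 k2] := @bracket_skew _ E; have [n1 n2] := @bracket_skew _ B.
have tri : trilinear c.1.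
  split=> [y z|x z|x y] k u v; apply: inj_i; rewrite linearP /= !cb.
  - by rewrite m1 !linearP /= l1 scalerBr; zmod.
  - by rewrite m2 !linearP /= l2 scalerBr; zmod.
  - by rewrite m3 !linearP /= l3 scalerBr; zmod.
have skw : skew3 c.1.
  split=> x y z; apply: inj_i; rewrite linearN /= !cb.
  - by rewrite k1 n1; zmod.
  - by rewrite k2 n2; zmod.
have regroup (a b d u v w : E) :
    a + u + (b + v) + (d + w) = a + b + d + (u + v + w) by zmod.
have alt0 : d_alt r c.1 = 0.
  apply/funext=> x1; apply/funext=> x2; apply/funext=> x3; apply/funext=> x4.
  apply/funext=> x5.
  (* The zero components put every entry in the shape s x + i a, so that the
     coordinate formula also rewrites the nested brackets. *)
  have := bracket_fundamental (s x1 + i 0) (s x2 + i 0) (s x3 + i 0)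
    (s x4 + i 0) (s x5 + i 0).
  rewrite !(bracket_coordinates _ _ _ _ _ _ cf) !linear0 !addr0.
  rewrite bracket_fundamental !(linearD s) /= regroup -!(linearD i).
  move=> /addrI/inj_i/eqP; rewrite -subr_eq0 => /eqP eq0.
  by rewrite -[RHS]eq0 /d_alt; zmod.
have hom0 : d_hom r c.2 + delta_alt (theta A) c.1 = 0.
  apply/funext=> x; apply/funext=> y; apply/funext=> z.
  have := esym (theta_derivation (s x + i 0) (s y + i 0) (s z + i 0)).
  rewrite !(bracket_coordinates _ _ _ _ _ _ cf, theta_coordinates _ _ cf).
  rewrite !linear0 !addr0 theta_derivation !(linearD s) /= regroup -!(linearD i).
  move=> /addrI/inj_i/eqP; rewrite -subr_eq0 => /eqP eq0.
  rewrite -[RHS]eq0 !addrfctE /d_hom /delta_alt; zmod.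
by split; [split | rewrite /partial2 alt0 hom0].
Qed.

Lemma factor_set_unique c c' : factor_set s c -> factor_set s c' -> c = c'.
Proof.
case: c c' => [psi la] [psi' la'] [/= cb ct] [/= cb' ct'].
congr (_, _); last by apply/lfunP=> x; apply: ext_inj_inj; rewrite ct ct'.
apply/funext=> x; apply/funext=> y; apply/funext=> z.
by apply: ext_inj_inj; rewrite cb cb'.
Qed.

Lemma section_shift alpha : is_section (s + (i \o alpha))%VF.
Proof.
apply/lfunP=> x; rewrite comp_lfunE add_lfunE comp_lfunE linearD /=.
by rewrite ext_projK sectionK // addr0 id_lfunE.
Qed.

(** This is where the sign of the second component of [partial1] comes from:
    s (theta x) enters the factor set negatively. *)
Lemma factor_set_shift c alpha : factor_set s c ->
  factor_set (s + (i \o alpha))%VF (c + partial1 r alpha).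
Proof.
move=> cf; split=> [x y z|x]; rewrite !(add_lfunE, comp_lfunE) -/i.
  rewrite (bracket_coordinates _ _ _ _ _ _ cf) /= /d_hom.
  change ((c + partial1 r alpha).1 x y z) with (c.1 x y z + d_hom r alpha x y z).
  by rewrite /d_hom !(linearD i, linearN i) /=; zmod.
rewrite (theta_coordinates _ _ cf).
change ((c + partial1 r alpha).2) with (c.2 - delta_hom (theta A) alpha).
rewrite /delta_hom !(add_lfunE, opp_lfunE, comp_lfunE) !(linearD i, linearN i) /=.
by zmod.
Qed.

Lemma section_difference s' : is_section s' ->
  exists alpha, s' = (s + (i \o alpha))%VF.
Proof.
move=> sE'; exists (i^-1 \o (s' - s))%VF; apply/lfunP=> x.
rewrite !(add_lfunE, comp_lfunE, opp_lfunE) ext_injVK.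
  by rewrite addrC subrK.
by rewrite linearB /= !sectionK // subrr.
Qed.
End FixedSection.

(** * Cocycles and equivalence of extensions *)

Definition classifies c := exists2 s, is_section s & factor_set s c.

Lemma classifies_exists : exists c, classifies c.
Proof.
have [s sE] := section_exists E; have [c cf] := factor_set_exists sE.
by exists c, s.
Qed.

Lemma classifies_cocycle c : classifies c -> cocycle2 r c.
Proof. by case=> s sE; apply: factor_set_cocycle. Qed.

(** A second cocycle comes from a second section, which is a shift of the first;
    a section determines its factor set. *)
Lemma classifies_coset c c' : classifies c ->
  classifies c' <-> exists alpha, c' = c + partial1 r alpha.
Proof.
move=> [s sE cf]; split=> [[s' sE' cf']|[alpha ->]].
  have [alpha ds] := section_difference sE sE'; exists alpha.
  by apply: (factor_set_unique cf'); rewrite ds; apply: factor_set_shift.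
by exists (s + (i \o alpha))%VF; [apply: section_shift|apply: factor_set_shift].
Qed.
End Extension.

Section Equivalence.
Variables (F : fieldType) (B A : lie3Der F) (r : representation B (theta A)).
Variables E1 E2 : abelian_extension B A.

Lemma classifies_equivalent c :
  equivalent_extensions E1 E2 -> classifies E1 c -> classifies E2 c.
Proof.
move=> [f [[fb ft] fi fp]] [s sE [cb ct]]; exists (f \o s)%VF.
  by rewrite /is_section comp_lfunA fp.
have fiE a : ext_inj E2 a = f (ext_inj E1 a) by rewrite -fi comp_lfunE.
by split=> *; rewrite fiE ?cb ?ct linearB /= !comp_lfunE ?fb ?ft.
Qed.

(** The map s1 x + i1 a |-> s2 x + i2 a respects brackets and derivations because
    these are given in coordinates by formulas that only involve r and c. *)
Lemma equivalent_of_classifies c : induces E1 r -> induces E2 r ->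
  classifies E1 c -> classifies E2 c -> equivalent_extensions E1 E2.
Proof.
move=> E1r E2r [s1 sE1 cf1] [s2 sE2 cf2].
pose p1 := ext_proj E1.
(* [a_of u] is the component a of u = s1 x + i1 a. *)
pose a_of := (((ext_inj E1)^-1) \o (\1 - (s1 \o p1)))%VF.
pose f := ((s2 \o p1) + (ext_inj E2 \o a_of))%VF.
have fE x a : f (s1 x + ext_inj E1 a) = s2 x + ext_inj E2 a.
  rewrite !(add_lfunE, comp_lfunE, opp_lfunE, id_lfunE) /p1 linearD /=.
  rewrite sectionK // ext_projK addr0 [s1 x + _]addrC addrK.
  by rewrite lker0_lfunK ?ext_inj_injective.
have decomp := ext_coordinates sE1; exists f; split.
- split=> [u v w|u].
    rewrite (decomp u) (decomp v) (decomp w).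
    by rewrite (bracket_coordinates E1r sE1 _ _ _ _ _ _ cf1) !fE
      (bracket_coordinates E2r sE2 _ _ _ _ _ _ cf2).
  by rewrite (decomp u) (theta_coordinates _ _ cf1) !fE
    (theta_coordinates _ _ cf2).
- apply/lfunP=> a; rewrite comp_lfunE -[ext_inj E1 a]add0r -(linear0 s1) fE.
  by rewrite linear0 add0r.
- apply/lfunP=> u; rewrite comp_lfunE {1}(decomp u) fE linearD /=.
  by rewrite ext_projK addr0 sectionK.
Qed.
End Equivalence.

(** * The extension defined by a cocycle *)

Section Realization.
Variables (F : fieldType) (A B : lie3Der F) (abelA : abelian_lie3 A).
Variables (r : representation B (theta A)) (c : cochain2_ambient B A).
Hypothesis c_cocycle : cocycle2 r c.

Let L : vectType F := (B * A)%type.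

(** The formula of [bracket_coordinates], with the pair (x, a) in the role of
    s x + i a. *)
Definition twisted_bracket (u v w : L) : L :=
  ([lie u.1, v.1, w.1],
   c.1 u.1 v.1 w.1 + r u.1 v.1 w.2 + r v.1 w.1 u.2 - r u.1 w.1 v.2).

Definition twisted_theta_fun (u : L) : L :=
  (theta B u.1, c.2 u.1 + theta A u.2).

Lemma twisted_theta_linear : linear twisted_theta_fun.
Proof.
move=> k u v; congr (_, _); rewrite /= ?linearP //.
by rewrite scalerDr; zmod.
Qed.

HB.instance Definition _ :=
  GRing.isLinear.Build F L L *:%R twisted_theta_fun twisted_theta_linear.

Definition twisted_theta : 'End(L) := linfun twisted_theta_fun.

Lemma twisted_thetaE u : twisted_theta u = twisted_theta_fun u.
Proof. by rewrite lfunE. Qed.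

Lemma twisted_bracket_trilinear : trilinear twisted_bracket.
Proof.
have [l1 l2 l3] := @bracket_trilinear _ B.
have [[[m1 m2 m3] _] _] := c_cocycle; have [r1 r2] := rho_bilinear r.
split=> [v w|u w|u v] k x y; congr (_, _) => /=.
- by rewrite l1.
- rewrite m1 !r1 !(add_lfunE, scale_lfunE) linearP /= !(scalerDr, scalerN).
  by zmod.
- by rewrite l2.
- rewrite m2 r1 r2 !(add_lfunE, scale_lfunE) linearP /= !(scalerDr, scalerN).
  by zmod.
- by rewrite l3.
- rewrite m3 !r2 !(add_lfunE, scale_lfunE) linearP /= !(scalerDr, scalerN).
  by zmod.
Qed.

Lemma twisted_bracket_skew : skew3 twisted_bracket.
Proof.
have [n1 n2] := @bracket_skew _ B; have [[_ [k1 k2]] _] := c_cocycle.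
have rN := rho_skew r.
split=> u v w; congr (_, _) => //=.
  by rewrite k1 (rN u.1) opp_lfunE; zmod.
by rewrite k2 (rN v.1) opp_lfunE; zmod.
Qed.

(** In the component along A, the terms in psi cancel by the cocycle condition,
    those in a3, a4 and a5 by the first axiom of a representation and those in
    a1 and a2 by the second. *)
Lemma twisted_bracket_fundamental x1 x2 x3 x4 x5 :
  twisted_bracket x1 x2 (twisted_bracket x3 x4 x5) =
    twisted_bracket (twisted_bracket x1 x2 x3) x4 x5
    + twisted_bracket x3 (twisted_bracket x1 x2 x4) x5
    + twisted_bracket x3 x4 (twisted_bracket x1 x2 x5).
Proof.
case: x1 x2 x3 x4 x5 => [x1 a1] [x2 a2] [x3 a3] [x4 a4] [x5 a5].
apply: injective_projections; first exact: bracket_fundamental.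
have pairD2 (u v : L) : (u + v).2 = u.2 + v.2 by [].
rewrite !pairD2 /=.
have [_ [alt0 _]] := c_cocycle.
have alt_x := congr1 (fun f => f x1 x2 x3 x4 x5) alt0.
apply/eqP; rewrite -subr_eq0; apply/eqP; refine (etrans _ alt_x).
rewrite /d_alt !(linearD (r _ _), linearN (r _ _)) /=.
rewrite (rho_compE r x1 x2 x3 x4) (rho_compE r x1 x2 x4 x5).
rewrite (rho_compE r x1 x2 x3 x5).
rewrite (rho_bracketE r x2 x3) (rho_bracketE r x1 x3).
by zmod.
Qed.

Definition twisted_lie3 : lie3 F := Lie3 twisted_bracket_trilinear
  twisted_bracket_skew twisted_bracket_fundamental.

(** In the component along A, the terms free of a, b and d cancel by the second
    half of the cocycle condition, the others by the compatibility of r with the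
    derivations. *)
Lemma twisted_theta_derivation : @derivation F twisted_lie3 twisted_theta.
Proof.
move=> [x a] [y b] [z d]; rewrite !twisted_thetaE; congr (_, _) => /=.
  by rewrite theta_derivation.
have [_ [_ hom0]] := c_cocycle.
have hom_x := congr1 (fun f => f x y z) hom0.
apply/esym/eqP; rewrite -subr_eq0; apply/eqP; refine (etrans _ hom_x).
rewrite !addrfctE /d_hom /delta_alt !(linearD (theta A), linearN (theta A)).
rewrite !(linearD (r _ _)) /= !rho_thetaE.
by zmod.
Qed.

Definition twisted_pair : lie3Der F := Lie3Der twisted_theta_derivation.

Definition twisted_inj_fun (a : A) : twisted_pair := (0, a).
Definition twisted_proj_fun (u : twisted_pair) : B := u.1.
Definition twisted_section_fun (x : B) : twisted_pair := (x, 0).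

Lemma twisted_inj_linear : linear twisted_inj_fun.
Proof. by move=> k a b; congr (_, _); rewrite /= scaler0 addr0. Qed.

Lemma twisted_proj_linear : linear twisted_proj_fun.
Proof. by []. Qed.

Lemma twisted_section_linear : linear twisted_section_fun.
Proof. by move=> k x y; congr (_, _); rewrite /= scaler0 addr0. Qed.

HB.instance Definition _ := GRing.isLinear.Build F A twisted_pair *:%R
  twisted_inj_fun twisted_inj_linear.
HB.instance Definition _ := GRing.isLinear.Build F twisted_pair B *:%R
  twisted_proj_fun twisted_proj_linear.
HB.instance Definition _ := GRing.isLinear.Build F B twisted_pair *:%R
  twisted_section_fun twisted_section_linear.

Definition twisted_inj : 'Hom(A, twisted_pair) := linfun twisted_inj_fun.
Definition twisted_proj : 'Hom(twisted_pair, B) := linfun twisted_proj_fun.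
Definition twisted_section : 'Hom(B, twisted_pair) := linfun twisted_section_fun.

Lemma twisted_injE a : twisted_inj a = (0, a).
Proof. by rewrite lfunE. Qed.

Lemma twisted_projE u : twisted_proj u = u.1.
Proof. by rewrite lfunE. Qed.

Lemma twisted_sectionE x : twisted_section x = (x, 0).
Proof. by rewrite lfunE. Qed.

Let B0 := trilinear0 (@bracket_trilinear _ B).
Let r0 := bilinear2_0 (rho_bilinear r).
Let psi0 := trilinear0 c_cocycle.1.1.

Lemma twisted_inj_morphism : lie3Der_morphism twisted_inj.
Proof.
split=> [x y z|x]; rewrite !twisted_injE.
  rewrite abelA; congr (_, _); first by rewrite B0.
  by rewrite /= psi0 !r0 !zero_lfunE !addr0 subr0.
by rewrite [RHS]twisted_thetaE /twisted_theta_fun /= !linear0 add0r.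
Qed.

Lemma twisted_proj_morphism : lie3Der_morphism twisted_proj.
Proof. by split=> *; rewrite !twisted_projE //= [X in X.1]twisted_thetaE. Qed.

Lemma twisted_inj_injective : lker twisted_inj = 0%VS.
Proof. by apply/eqP/lker0P=> a b; rewrite !twisted_injE => -[]. Qed.

Lemma twisted_exact : limg twisted_inj = lker twisted_proj.
Proof.
apply/vspaceP=> u; rewrite memv_ker twisted_projE.
apply/memv_imgP/eqP=> [[a _ ->]|u0]; first by rewrite twisted_injE.
by exists u.2; rewrite ?memvf // twisted_injE -u0 -surjective_pairing.
Qed.

Lemma twisted_sectionK : (twisted_proj \o twisted_section)%VF = \1%VF.
Proof.
by apply/lfunP=> x; rewrite comp_lfunE twisted_projE twisted_sectionE id_lfunE.
Qed.

Lemma twisted_proj_surjective : limg twisted_proj = fullv.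
Proof.
apply/vspaceP=> x; rewrite memvf; apply/memv_imgP.
exists (twisted_section x); first exact: memvf.
by rewrite twisted_projE twisted_sectionE.
Qed.

Lemma twisted_abelian (a b : A) (u : twisted_pair) :
  [lie twisted_inj a, twisted_inj b, u] = 0.
Proof.
rewrite !twisted_injE; congr (_, _); first by rewrite /= B0.
by rewrite /= psi0 !r0 !zero_lfunE !addr0 subr0.
Qed.

Definition twisted_extension : abelian_extension B A :=
  AbelianExtension twisted_inj_morphism twisted_proj_morphism
    twisted_inj_injective twisted_exact twisted_proj_surjective twisted_abelian.

Lemma twisted_induces : induces twisted_extension r.
Proof.
move=> s sE x y a; have sK := sectionK sE.
have s1 z : (s z).1 = z by rewrite -[RHS]sK [RHS]twisted_projE.
rewrite [LHS]twisted_injE [ext_inj _ _]twisted_injE; congr (_, _) => /=.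
  by rewrite B0.
by rewrite psi0 !r0 !zero_lfunE !s1 add0r addr0 subr0.
Qed.

Lemma twisted_classifies : classifies twisted_extension c.
Proof.
exists twisted_section; first exact: twisted_sectionK.
split=> [x y z|x].
  rewrite [LHS]twisted_injE !twisted_sectionE.
  apply: injective_projections => /=; first by rewrite subrr.
  by rewrite !linear0 !addr0.
rewrite [LHS]twisted_injE !twisted_sectionE [theta _ _]twisted_thetaE.
apply: injective_projections => /=; first by rewrite subrr.
by rewrite !linear0 !addr0.
Qed.

End Realization.

Lemma cocycle_realized (F : fieldType) (A B : lie3Der F)
    (r : representation B (theta A)) (c : cochain2_ambient B A) :
  abelian_lie3 A -> cocycle2 r c ->
  exists E : abelian_extension B A, induces E r /\ classifies E c.
Proof.
move=> abelA cc; exists (twisted_extension abelA cc).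
by split; [apply: twisted_induces | apply: twisted_classifies].
Qed.

(** * The correspondence *)

Section Correspondence.
Variables (F : fieldType) (A B : lie3Der F) (r : representation B (theta A)).

Definition coset2 (c : cochain2_ambient B A) : set (cochain2_ambient B A) :=
  [set c + b | b in coboundary2 r].

(** Both directions use the same relation [classifies], without choosing an
    extension or a cocycle. Only the second one has to require that E induces r,
    since a bare set of cochains does not remember the representation. *)
Definition cochains_of_class (S : abelian_extension B A -> Prop) :
    set (cochain2_ambient B A) :=
  [set c | exists2 E, S E & classifies E c].

Definition class_of_cochains (T : set (cochain2_ambient B A)) :
    abelian_extension B A -> Prop :=
  fun E => induces E r /\ exists2 c, T c & classifies E c.

Section OneExtension.
Variables (E : abelian_extension B A) (c : cochain2_ambient B A).
Hypotheses (Er : induces E r) (Ec : classifies E c).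

Lemma coset2_classifies c' : coset2 c c' <-> classifies E c'.
Proof.
split=> [[_ [alpha _ <-] <-]|/(classifies_coset Er _ Ec)[alpha ->]].
  by apply/(classifies_coset Er _ Ec); exists alpha.
by exists (partial1 r alpha) => //; exists alpha.
Qed.

Lemma cochains_of_equivalence_class :
  cochains_of_class (equivalent_extensions E) = coset2 c.
Proof.
apply/predeqP=> c'; split=> [[E' EE' E'c']|/coset2_classifies Ec'].
  apply/coset2_classifies; apply: classifies_equivalent E'c'.
  exact: equivalent_extensions_sym.
by exists E => //; apply: equivalent_extensions_refl.
Qed.

Lemma class_of_coset : class_of_cochains (coset2 c) = equivalent_extensions E.
Proof.
apply/predeqP=> E'; split=> [[E'r [c' /coset2_classifies Ec' E'c']]|EE'].
  exact: equivalent_of_classifies Er E'r Ec' E'c'.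
split; first exact: equivalent_extensions_induces EE' Er.
exists c; first by apply/coset2_classifies.
exact: classifies_equivalent EE' Ec.
Qed.

End OneExtension.

Lemma cochains_of_class_H2 (S : ext_class r) :
  exists c, cocycle2 r c /\ cochains_of_class (sval S) = coset2 c.
Proof.
case: S => _ /= [E [Er ->]]; have [c Ec] := classifies_exists E.
exists c; split; first exact: classifies_cocycle Er _ Ec.
exact: cochains_of_equivalence_class.
Qed.

Lemma class_of_cochains_ext (abelA : abelian_lie3 A) (T : H2 r) :
  exists E, induces E r /\ class_of_cochains (sval T) = equivalent_extensions E.
Proof.
case: T => _ /= [c [cc ->]]; have [E [Er Ec]] := cocycle_realized abelA cc.
by exists E; split=> //; apply: class_of_coset.
Qed.

Definition cohomology_of_extension (S : ext_class r) : H2 r :=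
  exist _ _ (cochains_of_class_H2 S).

Definition extension_of_cohomology (abelA : abelian_lie3 A) (T : H2 r) :
  ext_class r := exist _ _ (class_of_cochains_ext abelA T).

Lemma cohomology_of_extensionK (abelA : abelian_lie3 A) :
  cancel cohomology_of_extension (extension_of_cohomology abelA).
Proof.
move=> [S HS]; apply: eq_exist => /=; have [E [Er ->]] := HS.
have [c Ec] := classifies_exists E.
by rewrite (cochains_of_equivalence_class Er Ec) (class_of_coset Er Ec).
Qed.

Lemma extension_of_cohomologyK (abelA : abelian_lie3 A) :
  cancel (extension_of_cohomology abelA) cohomology_of_extension.
Proof.
move=> [T HT]; apply: eq_exist => /=; have [c [cc ->]] := HT.
have [E [Er Ec]] := cocycle_realized abelA cc.
by rewrite (class_of_coset Er Ec) (cochains_of_equivalence_class Er Ec).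
Qed.

End Correspondence.

Theorem theorem4p1 (F : closedFieldType) (charF0 : [pchar F]%R =i pred0)
    (A B : lie3Der F) (abelA : abelian_lie3 A)
    (r : representation B (theta A)) :
  exists f : ext_class r -> H2 r, bijective f.
Proof.
exists (@cohomology_of_extension F A B r).
exists (@extension_of_cohomology F A B r abelA).
- exact: cohomology_of_extensionK.
- exact: extension_of_cohomologyK.
Qed.
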